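(* Let $\kappa$ be a singular (uncountable) cardinal with $2^{<\kappa}=\kappa$, and let $X$ be a nonempty regular Hausdorff space of weight at most $\kappa$ such that every open subset of $X$ is a union of at most $\operatorname{cof}(\kappa)$-many closed sets (i.e. $\kappa\text{-}\boldsymbol{\Sigma}^0_1(X)\subseteq\operatorname{cof}(\kappa)^+\text{-}\boldsymbol{\Sigma}^0_2(X)$). For $1\le\alpha<\operatorname{ord}_{\kappa^+}(X)$, let $\widehat{\alpha}=\operatorname{cof}(\kappa)$ if $\alpha$ is a successor ordinal, and $\widehat{\alpha}=\operatorname{cof}(\alpha)$ if $\alpha$ is limit. Then: (1) $\kappa^+\text{-}\boldsymbol{\Sigma}^0_\alpha(X)$ is closed neither under complements nor under intersections of size $\widehat{\alpha}$; (2) $\kappa^+\text{-}\boldsymbol{\Pi}^0_\alpha(X)$ is closed neither under complements nor under unions of size $\widehat{\alpha}$; (3) if $\alpha>1$, then $\kappa^+\text{-}\boldsymbol{\Delta}^0_\alpha(X)$ is not closed under unions or intersections of size $\widehat{\alpha}$ (neither of the two), and the same is true for $\alpha=1$ if $X\subseteq{}^{\kappa}2$.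
   Context: For a topological space $X$ and an ordinal $\gamma>\omega$, define by recursion on ordinals $\alpha\ge 1$: $\gamma\text{-}\boldsymbol{\Sigma}^0_1(X)$ is the family of open sets; for $\alpha>1$, $\gamma\text{-}\boldsymbol{\Sigma}^0_\alpha(X)$ is the family of all unions $\bigcup_{\xi<\delta}A_\xi$ with $\delta<\gamma$ and each $A_\xi\in\bigcup_{1\le\beta<\alpha}\gamma\text{-}\boldsymbol{\Pi}^0_\beta(X)$; $\gamma\text{-}\boldsymbol{\Pi}^0_\alpha(X)$ is the family of complements of sets in $\gamma\text{-}\boldsymbol{\Sigma}^0_\alpha(X)$; $\gamma\text{-}\boldsymbol{\Delta}^0_\alpha(X)=\gamma\text{-}\boldsymbol{\Sigma}^0_\alpha(X)\cap\gamma\text{-}\boldsymbol{\Pi}^0_\alpha(X)$. $\gamma\text{-}\mathbf{Bor}(X)$ is the smallest family of subsets of $X$ containing the open sets and closed under complements and well-ordered unions of length less than $\gamma$. The order is $\operatorname{ord}_\gamma(X)=\min\{\alpha\in\mathrm{Ord}\mid\gamma\text{-}\boldsymbol{\Sigma}^0_\alpha(X)=\gamma\text{-}\mathbf{Bor}(X)\}$. The space ${}^{\kappa}2$ carries the bounded topology, generated by the sets $[s]=\{x\in{}^{\kappa}2\mid s\subseteq x\}$ for $s\in{}^{<\kappa}2$, and subsets of it carry the subspace topology. *)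

(* Defs.v *)
From HB Require Import structures.
From mathcomp Require Import all_boot all_classical topology.

Set Implicit Arguments.
Unset Strict Implicit.
Unset Printing Implicit Defensive.

Local Open Scope classical_set_scope.
Local Open Scope card_scope.

(* Ordinals are represented by well-ordered types.  Two representations of the
   same ordinal are related by [oeq] (order isomorphism), not by [=]. *)
Record Ord := MkOrd {
  ocar :> Type;
  ltel : ocar -> ocar -> Prop;
  ltel_trans : forall x y z, ltel x y -> ltel y z -> ltel x z;
  ltel_total : forall x y, [\/ ltel x y, x = y | ltel y x];
  ltel_wf : well_founded ltel }.

Definition oeq (A B : Ord) : Prop :=
  exists f : A -> B, (forall x y, ltel x y -> ltel (f x) (f y)) /\
                     (forall z, exists x, f x = z).

Section InitialSegment.
Variables (A : Ord) (a : A).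

Definition seg_car := {x : A | ltel x a}.
Definition seg_lt (x y : seg_car) := ltel (sval x) (sval y).

Fact seg_trans x y z : seg_lt x y -> seg_lt y z -> seg_lt x z.
Proof. exact: ltel_trans. Qed.

Fact seg_total x y : [\/ seg_lt x y, x = y | seg_lt y x].
Proof.
case: x y => [x xa] [y ya].
have [xy|xy|yx] := ltel_total x y; [exact: Or31| |exact: Or33].
by apply: Or32; exact: eq_exist.
Qed.

Fact seg_wf : well_founded seg_lt.
Proof.
have H (b : A) : Acc (@ltel A) b -> forall bS, @Acc seg_car seg_lt (exist _ b bS).
  by elim=> {}b _ IH bS; constructor=> -[c cS] cb; exact: IH.
by case=> b bS; apply: H; exact: ltel_wf.
Qed.

Definition oseg : Ord := MkOrd seg_trans seg_total seg_wf.
End InitialSegment.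

(* The ordinals below [B] are, up to isomorphism, the initial segments of [B]. *)
Definition olt (A B : Ord) : Prop := exists b : B, oeq A (oseg b).
Definition ole (A B : Ord) : Prop := olt A B \/ oeq A B.

Definition o0 : Ord.
Proof. by apply: (@MkOrd void (fun _ _ => False)) => -[]. Defined.

Section Successor.
Variable A : Ord.

Definition succ_lt (x y : option A) : Prop :=
  match x, y with
  | Some u, Some v => ltel u v
  | Some _, None => True
  | None, _ => False
  end.

Fact succ_trans x y z : succ_lt x y -> succ_lt y z -> succ_lt x z.
Proof. by case: x y z => [x|] [y|] [z|] //=; exact: ltel_trans. Qed.

Fact succ_total x y : [\/ succ_lt x y, x = y | succ_lt y x].
Proof.
case: x y => [x|] [y|]; [|exact: Or31|exact: Or33|exact: Or32].
by have [?|->|?] := ltel_total x y; [exact: Or31|exact: Or32|exact: Or33].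
Qed.

Fact succ_wf : well_founded succ_lt.
Proof.
have H (x : A) : Acc succ_lt (Some x).
  by elim: (ltel_wf x) => {}x _ IH; constructor=> -[y /IH|[]].
by case=> [x|]; [exact: H | constructor=> -[y _|[]]; exact: H].
Qed.

Definition oS : Ord := MkOrd succ_trans succ_total succ_wf.
End Successor.

Definition o1 : Ord := oS o0.
Definition o2 : Ord := oS o1.

Definition omega : Ord.
Proof.
apply: (@MkOrd nat (fun m n => (m < n)%N)).
- by move=> x y z; exact: ltn_trans.
- by move=> x y; have [?|?|?] := ltngtP x y; [exact: Or31|exact: Or33|exact: Or32].
- move=> n; constructor; elim: n => [|n IH] m; first by rewrite ltn0.
  by rewrite ltnS leq_eqVlt => /predU1P[->|/IH]; [constructor|].
Defined.

Definition is_succ (A : Ord) : Prop := exists B, oeq A (oS B).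

Definition is_omin (P : Ord -> Prop) (A : Ord) : Prop :=
  P A /\ forall B, P B -> ole A B.

(* The least ordinal satisfying [P]; [o0] is a default value, taken only when
   no ordinal satisfies [P]. *)
Definition omin (P : Ord -> Prop) : Ord :=
  if pselect (exists A, is_omin P A) is left h then sval (cid h) else o0.

(* Cardinals are initial ordinals. *)
Definition is_card (A : Ord) : Prop :=
  forall B, olt B A -> ~ ([set: A] #<= [set: B]).

Definition card_succ (A : Ord) : Ord := omin (fun B => is_card B /\ olt A B).

Definition cofinal (A B : Ord) (f : B -> A) : Prop :=
  forall a, exists b, a = f b \/ ltel a (f b).

Definition cof (A : Ord) : Ord := omin (fun B => exists f : B -> A, cofinal f).

Definition singular_cardinal (kappa : Ord) : Prop :=
  [/\ is_card kappa, olt omega kappa & olt (cof kappa) kappa].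

(* Binary sequences of length less than [kappa]. *)
Definition bseq (kappa : Ord) : Type := {d : kappa & oseg d -> bool}.

(* 2^{<kappa} = kappa *)
Definition pow_lt_eq (kappa : Ord) : Prop := [set: bseq kappa] #= [set: kappa].

Definition cantor (kappa : Ord) : Type := kappa -> bool.

Definition cone (kappa : Ord) (s : bseq kappa) : set (cantor kappa) :=
  [set x | forall i : oseg (projT1 s), x (sval i) = projT2 s i].

HB.instance Definition _ (kappa : Ord) := gen_eqMixin (cantor kappa).
HB.instance Definition _ (kappa : Ord) := gen_choiceMixin (cantor kappa).
(* The bounded topology, not the product topology. *)
HB.instance Definition _ (kappa : Ord) :=
  @isSubBaseTopological.Build (cantor kappa) (set (cantor kappa))
    (range (@cone kappa)) id.

(* [X] is, up to homeomorphism, a subset of [Y] with the subspace topology. *)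
Definition embeds (X Y : topologicalType) : Prop :=
  exists f : X -> Y, injective f /\
    (open : set (set X)) = [set f @^-1` V | V in open].

Definition weight_le (X : topologicalType) (kappa : Ord) : Prop :=
  exists2 B : set (set X), B #<= [set: kappa] & basis B.

Section Closure.
Variable T : Type.
Implicit Type F : set (set T).

Definition closed_compl F : Prop := forall A, F A -> F (~` A).

Definition closed_union (I : Ord) F : Prop :=
  forall A : I -> set T, (forall i, F (A i)) -> F (\bigcup_i A i).

Definition closed_inter (I : Ord) F : Prop :=
  forall A : I -> set T, (forall i, F (A i)) -> F (\bigcap_i A i).
End Closure.

Section Hierarchy.
Variables (X : topologicalType) (gamma : Ord).

(* Since [olt] is well-founded, the recursion on the level can be written as an
   inductive predicate; a set is Pi at level b iff its complement is Sigma. *)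
Inductive Sigma0 : Ord -> set X -> Prop :=
| Sigma0_open a U : oeq a o1 -> open U -> Sigma0 a U
| Sigma0_union a (d : Ord) (A : d -> set X) (b : d -> Ord) :
    olt o1 a -> olt d gamma ->
    (forall i, ole o1 (b i)) -> (forall i, olt (b i) a) ->
    (forall i, Sigma0 (b i) (~` A i)) ->
    Sigma0 a (\bigcup_i A i).

Definition Pi0 (a : Ord) : set (set X) := [set A | Sigma0 a (~` A)].

Definition Delta0 (a : Ord) : set (set X) := Sigma0 a `&` Pi0 a.

Definition Bor : set (set X) :=
  smallest (fun F => closed_compl F /\
                     forall d, olt d gamma -> closed_union d F) open.

Definition Bor_ord : Ord :=
  omin (fun a => ole o1 a /\ (Sigma0 a : set (set X)) = Bor).
End Hierarchy.

(* Used for [a >= 1], where "not a successor" means "limit". *)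
Definition hat (kappa a : Ord) : Ord :=
  if pselect (is_succ a) is left _ then cof kappa else cof a.

(* Main.v *)
Require Import Defs.
From mathcomp Require Import all_boot all_classical topology wochoice.

(** Write Sigma, Pi, Delta for the classes with unions of length below kappa^+.
    If Sigma_alpha were contained in Pi_alpha, then Sigma_alpha would be closed
    under complements and under unions of length at most kappa, hence equal to
    the whole algebra of Borel sets, which is excluded for alpha below the order
    of X ([not_Sigma_sub_Pi]).  Every closure property in the theorem is refuted
    by deriving this inclusion from it; passing to complements leaves only
    closure of Pi_alpha or Delta_alpha under unions to consider.  So let C be a
    family with Delta_alpha <= C <= Pi_alpha that is closed under unions of the
    prescribed size.  It suffices to build each set of Sigma_alpha from members
    of Delta_alpha by such unions, with intersections of length at most kappa
    under which Pi_alpha is closed in any case.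

    For alpha limit this is immediate, by grouping the sets in a union according
    to a cofinal sequence in alpha ([Sigma_sub_Pi_limit]).

    For alpha = beta + 1 a set of Sigma_alpha is a union of kappa sets of
    Pi_beta, hence a union of cof(kappa) pieces, each a union of lambda < kappa
    sets of Pi_beta, and each piece must be shown to lie in C
    ([Pi_small_bigcup]).  A set of Pi_beta is an intersection of cof(kappa) sets
    which are themselves intersections of fewer than kappa sets of Sigma_beta.
    The distributive law expresses a piece as an intersection, over the functions
    from lambda to cof(kappa), of unions of cof(kappa) sets of Delta_alpha.
    Here 2^(<kappa) = kappa enters: together with lambda * mu < kappa for
    lambda, mu < kappa ([hessenberg]) it gives mu^lambda <= kappa, so the
    intersections have length at most kappa ([inj_le_small_fun]).

    For alpha = 1 and C = Pi_1, open sets are unions of cof(kappa) closed sets by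
    hypothesis.  For alpha = 1 and C = Delta_1 in a subspace of the generalized
    Cantor space, an open set is the union over i < cof(kappa) of the cones of
    length kappa_i that it contains, and for each i their union is clopen
    ([open_clopen_union]).

    The preliminaries supply the facts on well-orders and cardinals that are
    used: comparability, existence of kappa^+, and kappa * kappa = kappa. *)

Set Implicit Arguments.
Unset Strict Implicit.
Unset Printing Implicit Defensive.

Local Open Scope classical_set_scope.

(** * Injections between types *)

Definition inj_le (S T : Type) : Prop := exists f : S -> T, injective f.

Lemma inj_leP S T : ([set: S] #<= [set: T])%card <-> inj_le S T.
Proof.
split=> [/card_leP[g]|[f f_inj]].
  exists (fun x => val (g (to_setT x))) => x y /val_inj.
  by move=> /(@inj _ _ _ g); rewrite !inE => /(_ Logic.I Logic.I) /(congr1 val).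
have /Pinj[g _] : {in [set: S] &, injective f}.
  by move=> x y _ _; exact: f_inj.
by apply: inj_card_le; exact: ('totalfun_[set: S] g).
Qed.

Lemma inj_le_refl T : inj_le T T.
Proof. by exists id. Qed.

Lemma inj_le_trans S T U : inj_le S T -> inj_le T U -> inj_le S U.
Proof. by move=> [f fi] [g gi]; exists (g \o f); exact: inj_comp. Qed.

Lemma sval_inj (T : Type) (P : T -> Prop) : injective (@sval T P).
Proof. by move=> [x p] [y q] /= e; exact: eq_exist. Qed.

Lemma inj_le_sig (T : Type) (P : T -> Prop) : inj_le {x | P x} T.
Proof. by exists sval; exact: sval_inj. Qed.

Lemma inj_le_prod S S' T T' :
  inj_le S S' -> inj_le T T' -> inj_le (S * T) (S' * T').
Proof.
move=> [f fi] [g gi]; exists (fun p => (f p.1, g p.2)).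
by move=> [a b] [c d] /= [/fi-> /gi->].
Qed.

Lemma cantor_inj_le T : ~ inj_le (T -> Prop) T.
Proof.
move=> [f fi]; pose D t := exists2 P : T -> Prop, f P = t & ~ P t.
have Df : ~ D (f D).
  by move=> h; have [P /fi e nD] := h; apply: nD; rewrite e.
by apply: (Df); exact: (ex_intro2 _ _ D).
Qed.

(** * Comparison of well-orders *)

Lemma ltel_irr (A : Ord) (x : A) : ~ ltel x x.
Proof. by elim: (ltel_wf x) => {}x _ IH xx; exact: (IH x). Qed.

Lemma ltel_asym (A : Ord) (x y : A) : ltel x y -> ~ ltel y x.
Proof. by move=> xy yx; apply: (@ltel_irr _ x); exact: ltel_trans yx. Qed.

Lemma ltel_least (A : Ord) (P : A -> Prop) : ~ (forall x, P x) ->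
  exists m, ~ P m /\ forall y, ltel y m -> P y.
Proof.
apply: contra_notP => no x; elim: (ltel_wf x) => {}x _ IH.
by apply: contrapT => Px; apply: no; exists x.
Qed.

Lemma ltel_mono_reflect (A B : Ord) (f : A -> B) :
  (forall x y, ltel x y -> ltel (f x) (f y)) ->
  forall x y, ltel (f x) (f y) -> ltel x y.
Proof.
move=> fm x y fxy; have [//|e|/fm yx] := ltel_total x y.
  by rewrite e in fxy; have := ltel_irr fxy.
by have := ltel_asym fxy.
Qed.

Lemma ltel_mono_inj (A B : Ord) (f : A -> B) :
  (forall x y, ltel x y -> ltel (f x) (f y)) -> injective f.
Proof.
move=> fm x y e; have [/fm|//|/fm] := ltel_total x y; rewrite e.
all: by move/ltel_irr.
Qed.

(** A point moved down would be mapped to a smaller point moved down. *)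
Lemma ltel_mono_ge (A : Ord) (f : A -> A) :
  (forall x y, ltel x y -> ltel (f x) (f y)) -> forall x, ~ ltel (f x) x.
Proof.
move=> fm x; elim: (ltel_wf x) => {}x _ IH fx.
by apply: (IH _ fx); exact: fm.
Qed.

Lemma oeq_refl (A : Ord) : oeq A A.
Proof. by exists id; split=> // x; exists x. Qed.

Lemma oeq_sym (A B : Ord) : oeq A B -> oeq B A.
Proof.
move=> [f [fm /choice[g gK]]]; exists g; split.
  by move=> x y xy; apply: (ltel_mono_reflect fm); rewrite !gK.
by move=> x; exists (f x); apply: (ltel_mono_inj fm); rewrite gK.
Qed.

Lemma oeq_trans (A B C : Ord) : oeq A B -> oeq B C -> oeq A C.
Proof.
move=> [f [fm fs]] [g [gm gs]]; exists (g \o f); split.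
  by move=> x y /fm/gm.
by move=> z; have [y <-] := gs z; have [x <-] := fs y; exists x.
Qed.

Lemma oseg_image (A B : Ord) (f : A -> B) (a : A) :
  (forall x y, ltel x y -> ltel (f x) (f y)) ->
  (forall y, ltel y (f a) -> exists x, f x = y) ->
  oeq (oseg a) (oseg (f a)).
Proof.
move=> fm fs.
exists (fun x : oseg a => exist _ (f (sval x)) (fm _ _ (svalP x)) : oseg (f a)).
split=> [x y|[y yb]]; first exact: fm.
have [x e] := fs y yb.
have xa : ltel x a by apply: (ltel_mono_reflect fm); rewrite e.
by exists (exist _ x xa); exact: sval_inj.
Qed.

Lemma oseg_oseg (A : Ord) (a : A) (x : oseg a) : oeq (oseg x) (oseg (sval x)).
Proof.
apply: (@oseg_image (oseg a) A sval) => // y yx.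
by exists (exist _ y (ltel_trans yx (svalP x))).
Qed.

Lemma oeq_oseg (A B : Ord) : oeq A B ->
  exists f : A -> B, (forall a, oeq (oseg a) (oseg (f a))) /\
   (forall b, exists a, f a = b).
Proof.
by move=> [f [fm fs]]; exists f; split=> // a; apply: oseg_image.
Qed.

Lemma olt_oseg (A : Ord) (a : A) : olt (oseg a) A.
Proof. by exists a; exact: oeq_refl. Qed.

Lemma olt_oeql (A B C : Ord) : oeq A B -> olt B C -> olt A C.
Proof. by move=> AB [c Bc]; exists c; exact: oeq_trans Bc. Qed.

Lemma olt_oeqr (A B C : Ord) : olt A B -> oeq B C -> olt A C.
Proof.
move=> [b Ab] /oeq_oseg[f [fb _]].
by exists (f b); exact: oeq_trans (fb b).
Qed.

Lemma olt_trans (A B C : Ord) : olt A B -> olt B C -> olt A C.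
Proof.
move=> [b Ab] [c /oeq_oseg[f [fb _]]].
exists (sval (f b)); apply: oeq_trans Ab _; apply: oeq_trans (fb b) _.
exact: oseg_oseg.
Qed.

Lemma olt_irr (A : Ord) : ~ olt A A.
Proof.
move=> [a [f [fm _]]].
by apply: (@ltel_mono_ge A (fun x => sval (f x)) fm a); exact: (svalP (f a)).
Qed.

Lemma olt_osegs (A : Ord) (a b : A) : ltel a b -> olt (oseg a) (oseg b).
Proof.
move=> ab; exists (exist _ a ab); apply: oeq_sym.
exact: (oseg_oseg (exist _ a ab : oseg b)).
Qed.

Definition omax (A : Ord) (x y : A) : A := if pselect (ltel x y) then y else x.

Lemma omaxl (A : Ord) (x y : A) : ~ ltel (omax x y) x.
Proof.
rewrite /omax; case: pselect => [xy|nxy] /=; first exact: ltel_asym xy.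
exact: ltel_irr.
Qed.

Lemma omaxr (A : Ord) (x y : A) : ~ ltel (omax x y) y.
Proof. by rewrite /omax; case: pselect => [xy|//] /=; exact: ltel_irr. Qed.

Lemma nlt_trans (A : Ord) (x y z : A) : ~ ltel y x -> ~ ltel z y -> ~ ltel z x.
Proof.
move=> yx zy zx; have [xy|e|//] := ltel_total x y.
  by apply: zy; exact: ltel_trans xy.
by apply: zy; rewrite -e.
Qed.

Lemma olt_ind (P : Ord -> Prop) :
  (forall A, (forall B, olt B A -> P B) -> P A) -> forall A, P A.
Proof.
move=> IH A; apply: (IH) => B [a Ba].
elim: (ltel_wf a) B Ba => {}a _ IHa B Ba; apply: IH => C CB.
have [[x xa] Cx] := olt_oeqr CB Ba.
by apply: (IHa x xa); apply: oeq_trans Cx _; exact: oseg_oseg.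
Qed.

(** Either the range is everything, or it is the segment below the least point
    it misses. *)
Lemma initial_ole (A B : Ord) (f : A -> B) :
  (forall x y, ltel x y -> ltel (f x) (f y)) ->
  (forall x y, ltel y (f x) -> exists x', f x' = y) -> ole A B.
Proof.
move=> fm fi.
have [fs|] := pselect (forall b, exists a, f a = b); first by right; exists f.
move=> /ltel_least[m [mP mmin]]; left.
exists m.
have fltm a : ltel (f a) m.
  have [//|e|/fi[x e]] := ltel_total (f a) m; case: mP; first by exists a.
  by exists x.
exists (fun a => exist _ (f a) (fltm a)); split=> [x y|[y ym]]; first exact: fm.
by have [a e] := mmin y ym; exists a; exact: sval_inj.
Qed.

(** Matching points with isomorphic segments gives a monotone correspondence with
    initial domain and initial range.  If both were proper, the least unmatched
    points on the two sides would have isomorphic segments and be matched. *)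
Lemma olt_total (A B : Ord) : [\/ olt A B, oeq A B | olt B A].
Proof.
pose R (a : A) (b : B) := oeq (oseg a) (oseg b).
have Rm a a' b b' : R a b -> R a' b' -> ltel a' a -> ltel b' b.
  move=> ab ab' aa'; have H : olt (oseg b') (oseg b).
    apply: olt_oeql (oeq_sym ab') _; apply: olt_oeqr ab.
    exact: olt_osegs.
  have [//|e|bb'] := ltel_total b' b.
    by rewrite e in H; have := olt_irr H.
  by have := @olt_irr _ (olt_trans H (olt_osegs bb')).
have Rm' a a' b b' : R a b -> R a' b' -> ltel b' b -> ltel a' a.
  move=> ab ab' bb'; have [e|e|h] := ltel_total a' a => //.
    move: ab'; rewrite e => ab'.
    have /olt_irr[] : olt (oseg b') (oseg b').
    exact: olt_oeqr (olt_osegs bb') (oeq_trans (oeq_sym ab) ab').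
  by have := ltel_asym bb' (Rm _ _ _ _ ab' ab h).
have Rdown a b : R a b -> forall y, ltel y b -> exists x, R x y.
  move=> /oeq_sym/oeq_oseg[f [fR _]] y yb; exists (sval (f (exist _ y yb))).
  apply: oeq_sym.
  apply: oeq_trans (oeq_sym (oseg_oseg (exist _ y yb : oseg b))) _.
  by apply: oeq_trans (fR _) _; exact: oseg_oseg.
have Rdown' a b : R a b -> forall x, ltel x a -> exists y, R x y.
  move=> /oeq_oseg[f [fR _]] x xa; exists (sval (f (exist _ x xa))).
  apply: oeq_trans (oeq_sym (oseg_oseg (exist _ x xa : oseg a))) _.
  by apply: oeq_trans (fR _) _; exact: oseg_oseg.
have [/choice[f fR]|/ltel_least[a [aP amin]]] :=
  pselect (forall a, exists b, R a b).
  have [||h|h] := @initial_ole A B f; [| |exact: Or31|exact: Or32].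
  - by move=> x y; exact: Rm.
  - move=> x y h; have [x' x'y] := Rdown _ _ (fR x) y h; exists x'.
    have [h'|//|h'] := ltel_total (f x') y.
      by have := ltel_irr (Rm' _ _ _ _ x'y (fR x') h').
    by have := ltel_irr (Rm' _ _ _ _ (fR x') x'y h').
have [/choice[f fR]|/ltel_least[b [bP bmin]]] :=
  pselect (forall b, exists a, R a b).
  have [||h|h] := @initial_ole B A f;
    [| |exact: Or33|by apply: Or32; exact: oeq_sym].
  - by move=> x y; exact: Rm'.
  - move=> x y h; have [x' x'y] := Rdown' _ _ (fR x) y h; exists x'.
    have [h'|//|h'] := ltel_total (f x') y.
      by have := ltel_irr (Rm _ _ _ _ x'y (fR x') h').
    by have := ltel_irr (Rm _ _ _ _ (fR x') x'y h').
(* the correspondence is an isomorphism between the segments at a and b *)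
case: (aP); exists b.
have /choice[f fR] : forall x : oseg a, exists y : B, R (sval x) y.
  by move=> [x xa]; exact: amin.
have fb x : ltel (f x) b.
  have [//|e|h] := ltel_total (f x) b; case: bP.
    by rewrite -e; exists (sval x).
  exact: Rdown (fR x) _ h.
exists (fun x => exist _ (f x) (fb x)); split=> [x y|[y yb]]; first exact: Rm.
have [x xy] := bmin y yb.
have xa : ltel x a.
  have [//|e|h] := ltel_total x a; first by case: aP; exists y; rewrite -e.
  by case: aP; exact: Rdown' xy _ h.
exists (exist _ x xa); apply: sval_inj => /=.
have := fR (exist _ x xa) => /= xf.
have [h'|//|h'] := ltel_total (f (exist _ x xa)) y.
  by have := ltel_irr (Rm' _ _ _ _ xy xf h').
by have := ltel_irr (Rm' _ _ _ _ xf xy h').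
Qed.

(** * Least ordinals and successors *)

(** Ordinals are totally ordered and well-founded, so the default value in the
    definition of [omin] is taken only when [P] is empty. *)
Lemma omin_spec (P : Ord -> Prop) : (exists A, P A) -> is_omin P (omin P).
Proof.
move=> [A PA]; rewrite /omin; case: pselect => [h|no].
  exact: svalP (cid h).
exfalso; move: A PA; apply: olt_ind => A IH PA.
apply: no; exists A; split=> // B PB.
by have [h|h|/IH] := olt_total A B; [left|right|move/(_ PB)].
Qed.

Lemma ole_not_olt (A B : Ord) : ole A B -> ~ olt B A.
Proof.
move=> [AB BA|AB BA]; first exact: olt_irr (olt_trans AB BA).
exact: olt_irr (olt_oeqr BA AB).
Qed.

Lemma inj_le_oeq (A B : Ord) : oeq A B -> inj_le A B.
Proof. by move=> [f [fm _]]; exists f; exact: ltel_mono_inj fm. Qed.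

Lemma inj_le_olt (A B : Ord) : olt A B -> inj_le A B.
Proof.
move=> [b /inj_le_oeq Ab]; apply: inj_le_trans Ab _; exact: inj_le_sig.
Qed.

Lemma ole_olt_trans (A B C : Ord) : ole A B -> olt B C -> olt A C.
Proof. by move=> [AB|AB] BC; [exact: olt_trans BC|exact: olt_oeql BC]. Qed.

Lemma olt_ole_trans (A B C : Ord) : olt A B -> ole B C -> olt A C.
Proof. by move=> AB [BC|BC]; [exact: olt_trans BC|exact: olt_oeqr BC]. Qed.

Lemma oseg_None (B : Ord) : oeq B (oseg (None : oS B)).
Proof.
exists (fun x => exist (fun y : oS B => ltel y None) (Some x) Logic.I).
by split=> // -[[x|//] h]; exists x; apply: sval_inj.
Qed.

Lemma olt_oS (B : Ord) : olt B (oS B).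
Proof. by exists None; exact: oseg_None. Qed.

Lemma olt_oS_ole (A B : Ord) : olt A (oS B) -> ole A B.
Proof.
move=> [[x|] Ax]; [left|right].
  exists x; apply: oeq_trans Ax _; apply: oeq_sym.
  by apply: (@oseg_image B (oS B) Some) => // -[y|//] _; exists y.
by apply: oeq_trans Ax _; apply: oeq_sym; exact: oseg_None.
Qed.

Lemma olt_o1_o2 : olt o1 o2.
Proof. exact: olt_oS. Qed.

Lemma oeq_oS_max (A : Ord) (m : A) :
  (forall x, ~ ltel m x) -> oeq A (oS (oseg m)).
Proof.
move=> mmax; apply: oeq_sym.
exists (fun o : oS (oseg m) => if o is Some y then sval y else m); split.
  by move=> [x|] [y|] //= _; exact: (svalP x).
move=> z; have [h|->|/mmax//] := ltel_total z m; last by exists None.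
by exists (Some (exist _ z h)).
Qed.

Lemma ole_refl A : ole A A.
Proof. by right; exact: oeq_refl. Qed.

(** * Successor cardinals and cofinality *)

(** Zermelo's theorem for an arbitrary type. *)
Lemma well_orderable (T : Type) : exists A : Ord, ocar A = T.
Proof.
have [R Rwo] := well_ordering_principle {classic T}.
have Rmin (P : T -> Prop) : (exists x, P x) ->
    exists m, P m /\ forall x, P x -> R m x.
  move=> [x Px].
  have [|m [[mP mm] _]] := Rwo [pred z : {classic T} | `[< P z >]].
    by exists x; exact/asboolP.
  exists m; split; first by move: mP => /asboolP.
  by move=> z Pz; apply: mm; exact/asboolP.
have Ranti x y : R x x -> R y y -> R x y -> R y x -> x = y.
  move=> xx yy xy yx.
  have [|m [_ mu]] := Rwo (pred2 x y); first by exists x; rewrite !inE eqxx.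
  have <- : m = x.
    apply: mu; split; first by rewrite !inE eqxx.
    by move=> z; rewrite !inE => /orP[]/eqP->.
  apply: mu; split; first by rewrite !inE eqxx orbT.
  by move=> z; rewrite !inE => /orP[]/eqP->.
have Rxx x : R x x.
  by have [|m [-> ->]] := Rmin (fun z => z = x); first by exists x.
have Rtot x y : R x y \/ R y x.
  have [|m [[->|->] h]] := Rmin (fun z => z = x \/ z = y).
  - by exists x; left.
  - by left; apply: h; right.
  - by right; apply: h; left.
(* the strict part of R, which is total *)
have tr x y z : ~ R y x -> ~ R z y -> ~ R z x.
  move=> yx zy zx.
  have [|m [mP h]] := Rmin (fun u => [\/ u = x, u = y | u = z]).
    by exists x; apply: Or31.
  have [hx hy hz] : [/\ R m x, R m y & R m z].
    by split; apply: h; [apply: Or31|apply: Or32|apply: Or33].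
  case: mP => e; rewrite e in hx hy hz => //.
  by rewrite (Ranti x z) // in yx; case: (Rtot y z).
have tot x y : [\/ ~ R y x, x = y | ~ R x y].
  have [xy|] := pselect (R x y); last by move=> h; apply: Or33.
  have [yx|] := pselect (R y x); last by move=> h; apply: Or31.
  by apply: Or32; exact: Ranti.
have wf : well_founded (fun x y => ~ R y x).
  move=> x; apply: contrapT => nx.
  have [|m [nm h]] := Rmin (fun x => ~ Acc (fun x y => ~ R y x) x).
    by exists x.
  by apply: nm; constructor=> y my; apply: contrapT => /h.
by exists (@MkOrd T _ tr tot wf).
Qed.

(** The least ordinal that does not inject into [K] exists because the power set
    of [K] can be well-ordered; it is a cardinal above [K], so [card_succ K] is
    a true minimum and lies at or below it.  Hence everything below [card_succ K]
    injects into [K], which turns lengths of unions into a cardinality bound. *)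
Section CardSucc.
Variable K : Ord.

Let noninjecting (A : Ord) := ~ inj_le A K.
Let hartogs := omin noninjecting.

Let hartogs_spec : is_omin noninjecting hartogs.
Proof.
apply: omin_spec; have [A e] := well_orderable (K -> Prop).
by exists A; rewrite /noninjecting e; exact: cantor_inj_le.
Qed.

Let hartogs_card : is_card hartogs /\ olt K hartogs.
Proof.
have [nK least] := hartogs_spec; split.
  move=> B Bh /inj_leP hB.
  have [|/least/ole_not_olt//] := pselect (inj_le B K).
  by move=> BK; apply: nK; exact: inj_le_trans BK.
have [hK|hK|//] := olt_total hartogs K; case: nK; first exact: inj_le_olt.
exact: inj_le_oeq.
Qed.

Let card_succ_spec : is_omin (fun B => is_card B /\ olt K B) (card_succ K).
Proof. by apply: omin_spec; exists hartogs; exact: hartogs_card. Qed.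

Lemma lt_card_succ : olt K (card_succ K).
Proof. by have [[]] := card_succ_spec. Qed.

Lemma lt_card_succ_inj_le d : olt d (card_succ K) -> inj_le d K.
Proof.
move=> dK; apply: contrapT => nd.
have [_ /(_ _ nd)/ole_not_olt[]] := hartogs_spec.
have [_ /(_ _ hartogs_card)] := card_succ_spec.
exact: olt_ole_trans dK.
Qed.
End CardSucc.

Lemma cof_cofinal (A : Ord) : exists f : cof A -> A, cofinal f.
Proof.
suff [] : is_omin (fun B => exists f : B -> A, cofinal f) (cof A) by [].
by apply: omin_spec; exists A, id => a; exists a; left.
Qed.

(** * Infinite cardinals are equal to their squares *)

Section Pullback.
Variables (A : Ord) (T : Type) (f : T -> A).
Hypothesis f_inj : injective f.

Let pull_lt (x y : T) := ltel (f x) (f y).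
Let pull_trans x y z : pull_lt x y -> pull_lt y z -> pull_lt x z.
Proof. exact: ltel_trans. Qed.
Let pull_total x y : [\/ pull_lt x y, x = y | pull_lt y x].
Proof.
have [h|/f_inj h|h] := ltel_total (f x) (f y).
- exact: Or31.
- exact: Or32.
- exact: Or33.
Qed.
Let pull_wf : well_founded pull_lt.
Proof.
move=> x; move: {2}(f x) (erefl (f x)) => a.
elim: (ltel_wf a) x => {}a _ IH x xa.
by constructor=> y yx; apply: (IH (f y)) => //; rewrite -xa.
Qed.

(** The order induced on a type by an injection into a well-order. *)
Definition opull : Ord := MkOrd pull_trans pull_total pull_wf.
End Pullback.

Section Lexicographic.
Variables A B : Ord.

Let lex_lt (x y : A * B) := ltel x.1 y.1 \/ x.1 = y.1 /\ ltel x.2 y.2.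
Let lex_trans x y z : lex_lt x y -> lex_lt y z -> lex_lt x z.
Proof.
case: x y z => [a b] [a' b'] [a'' b''] [/= h|[/= -> h]] [/= k|[/= <- k]].
- by left; exact: ltel_trans k.
- by left.
- by left.
- by right; split=> //; exact: ltel_trans k.
Qed.
Let lex_total x y : [\/ lex_lt x y, x = y | lex_lt y x].
Proof.
case: x y => [a b] [a' b']; have [h|->|h] := ltel_total a a'.
- by apply: Or31; left.
- have [h|->|h] := ltel_total b b'; last by apply: Or33; right.
    by apply: Or31; right.
  exact: Or32.
- by apply: Or33; left.
Qed.
Let lex_wf : well_founded lex_lt.
Proof.
move=> [a b]; elim: (ltel_wf a) b => {}a _ IHa b.
elim: (ltel_wf b) => {}b _ IHb.
by constructor=> -[a' b'] [/= /IHa//|[/= -> /IHb//]].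
Qed.

Definition olex : Ord := MkOrd lex_trans lex_total lex_wf.
End Lexicographic.

(** Shift along an embedded copy of [nat] to make room for one more point. *)
Lemma inj_le_option_infinite S : inj_le nat S -> inj_le (option S) S.
Proof.
move=> [f fi].
have /choice[g gP] : forall s, exists t, (exists n, f n = s /\ t = f n.+1) \/
    (~ (exists n, f n = s) /\ t = s).
  move=> s; have [[n e]|no] := pselect (exists n, f n = s).
    by exists (f n.+1); left; exists n.
  by exists s; right.
exists (fun o => if o is Some s then g s else f 0).
have g0 s : g s <> f 0.
  by have [[n [_ ->]] /fi|[no ->] e] := gP s; last by apply: no; exists 0.
have gi : injective g.
  move=> s s'; have [[n [<- ->]]|[no ->]] := gP s;
    have [[n' [<- ->]]|[no' ->]] := gP s'.
  - by move=> /fi[->].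
  - by move=> e; case: no'; exists n.+1.
  - by move=> e; case: no; exists n'.+1.
  - by [].
by move=> [s|] [s'|] //; [move=> /gi->|move/g0|move/esym/g0].
Qed.

Lemma finite_option S : finite_set [set: S] -> finite_set [set: option S].
Proof.
move=> fS; have -> : [set: option S] = (Some @` [set: S]) `|` [set None].
  by apply/seteqP; split=> // -[s|] _; [left; exists s|right].
by rewrite finite_setU; split; [exact: finite_image|exact: finite_set1].
Qed.

Lemma not_inj_le_nat S : ~ inj_le nat S -> finite_set [set: S].
Proof. by move=> nS; apply: contrapT => /infiniteP/inj_leP. Qed.

Lemma inj_le_nat_finite S : inj_le nat S -> ~ finite_set [set: S].
Proof. by move=> nS; apply/infiniteP/inj_leP. Qed.

Lemma inj_le_closed_seg (A : Ord) (m : A) :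
  inj_le {x | ~ ltel m x} (option (oseg m)).
Proof.
have /choice[g gP] : forall x : {x | ~ ltel m x}, exists o : option (oseg m),
    if o is Some y then sval y = sval x else sval x = m.
  move=> [x xm]; have [h|e|//] := ltel_total x m; last by exists None.
  by exists (Some (exist _ x h)).
exists g => x y e; have := gP x; have := gP y; rewrite e.
by case: (g y) => [z|] yE xE; apply: sval_inj; [rewrite -xE|rewrite xE].
Qed.

(** By induction on [A], which may be assumed not to inject into a proper segment.
    Order [A * A] by maximum and then lexicographically.  If this order were
    longer than [A], a copy of [A] would lie below some pair with maximum [M],
    hence inside the square of the closed segment at [M].  That square is finite
    or, by induction, no larger than the segment at [M]; both are absurd. *)
Lemma hessenberg (A : Ord) : inj_le nat A -> inj_le (A * A) A.
Proof.
move: A; apply: olt_ind => A IH Ainf.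
have [[m Am]|Acard] := pselect (exists m : A, inj_le A (oseg m)).
  have mA := inj_le_sig (fun x => ltel x m).
  apply: inj_le_trans (inj_le_prod Am Am) _; apply: inj_le_trans mA.
  apply: (IH (oseg m) (olt_oseg m)); exact: inj_le_trans Am.
pose e (p : A * A) : olex A (olex A A) := (omax p.1 p.2, p).
have ei : injective e by move=> p q [_].
have [h|h|[p Ap]] := olt_total (opull ei) A; first exact: (inj_le_olt h).
  exact: (inj_le_oeq h).
pose M := omax p.1 p.2.
have Mi : inj_le A ({x | ~ ltel M x} * {x | ~ ltel M x}).
  apply: inj_le_trans (inj_le_oeq Ap) _.
  have qM (q : oseg p) : ~ ltel M (omax (sval q).1 (sval q).2).
    by case: (svalP q) => [/ltel_asym|[/= -> _]] //; exact: ltel_irr.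
  have q1 (q : oseg p) : ~ ltel M (sval q).1.
    by apply: nlt_trans (qM q); exact: omaxl.
  have q2 (q : oseg p) : ~ ltel M (sval q).2.
    by apply: nlt_trans (qM q); exact: omaxr.
  pose C x := ~ ltel M x.
  exists (fun q => (exist C _ (q1 q), exist C _ (q2 q))).
  move=> q q' [e1 e2]; apply: sval_inj.
  by case: (sval q) (sval q') e1 e2 => [a b] [a' b'] /= -> ->.
have Mo : inj_le A (option (oseg M) * option (oseg M)).
  by apply: inj_le_trans Mi _; apply: inj_le_prod; exact: inj_le_closed_seg.
have [Minf|/not_inj_le_nat/finite_option fM] := pselect (inj_le nat (oseg M)).
  case: Acard; exists M; apply: inj_le_trans Mo _.
  apply: inj_le_trans (IH _ (olt_oseg M) Minf).
  by apply: inj_le_prod; exact: inj_le_option_infinite.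
case: (inj_le_nat_finite (inj_le_trans Ainf Mo)).
by rewrite -setXTT; exact: finite_setX.
Qed.

(** Adding a top element to an infinite set does not change its cardinality. *)
Lemma infinite_card_no_max (A : Ord) : is_card A -> inj_le nat A ->
  forall m : A, exists m', ltel m m'.
Proof.
move=> Ac Ainf m; apply: contrapT => no.
have Am : inj_le A (option (oseg m)).
  apply: inj_le_trans (inj_le_closed_seg m).
  have h x : ~ ltel m x by move=> mx; apply: no; exists x.
  by exists (fun x => exist _ x (h x)) => x y [].
apply: (Ac _ (olt_oseg m)); apply/inj_leP; apply: (inj_le_trans Am).
apply: inj_le_option_infinite; apply: contrapT => /not_inj_le_nat/finite_option.
by apply: inj_le_nat_finite; exact: inj_le_trans Am.
Qed.

Lemma inj_le_oseg (A : Ord) (a b : A) : ~ ltel b a -> inj_le (oseg a) (oseg b).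
Proof.
move=> ba; have H (x : A) : ltel x a -> ltel x b.
  have [h|<-//|//] := ltel_total a b; move=> xa; exact: ltel_trans h.
exists (fun x => exist _ (sval x) (H _ (svalP x)) : oseg b).
by move=> x y [] /sval_inj.
Qed.

Lemma inj_le_bool U V : inj_le U V -> inj_le (U -> bool) (V -> bool).
Proof.
move=> [e ei]; exists (fun P v => `[< exists2 u, e u = v & P u >]).
move=> P Q PQ; apply/funext => u.
have H (S : U -> bool) : `[< exists2 u', e u' = e u & S u' >] = S u.
  by apply/asboolP/idP => [[u' /ei->]|Su] //; exists u.
by rewrite -(H P) -(H Q); exact: (congr1 (@^~ (e u)) PQ).
Qed.

Lemma inj_le_graph S T : inj_le (S -> T) (S * T -> bool).
Proof.
exists (fun f p => `[< f p.1 = p.2 >]) => f g fg; apply/funext => s.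
have /= := congr1 (@^~ (s, f s)) fg.
by rewrite asboolT // => /esym/asboolP.
Qed.

(** The cofinal family is pushed up by one step, so that each point is strictly
    bounded and every segment [oseg (h j)] is inhabited; the latter keeps
    intersections indexed by these segments from being degenerate. *)
Lemma cofinal_strict (kappa : Ord) : is_card kappa -> inj_le nat kappa ->
  exists h : cof kappa -> kappa,
    (forall a, exists j, ltel a (h j)) /\ (forall j, exists a, ltel a (h j)).
Proof.
move=> kc kinf; have [f fc] := cof_cofinal kappa.
have /choice[s sP] := infinite_card_no_max kc kinf.
exists (s \o f); split=> [a|j]; last by exists (f j); exact: sP.
have [j [->|h]] := fc a; exists j; first exact: sP.
exact: ltel_trans h (sP _).
Qed.

(** * Functions between sets smaller than the cardinal *)

Section SmallFunctions.
Variable kappa : Ord.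
Hypothesis kappa_omega : olt omega kappa.
Hypothesis kappa_pow : pow_lt_eq kappa.

(** A function from [S] to [T] is a subset of [S * T], which has the cardinality
    of a proper segment of [kappa]; subsets of a segment are binary sequences of
    length below [kappa], and there are only [kappa] of those. *)
Lemma inj_le_small_fun S T (a b : kappa) :
  inj_le S (oseg a) -> inj_le T (oseg b) -> inj_le (S -> T) kappa.
Proof.
move=> Sa Tb; have [w omw] := kappa_omega.
pose m := omax w (omax a b).
have wm : ~ ltel m w by exact: omaxl.
have abm : ~ ltel m (omax a b) by exact: omaxr.
have am : ~ ltel m a by apply: nlt_trans abm; exact: omaxl.
have bm : ~ ltel m b by apply: nlt_trans abm; exact: omaxr.
have minf : inj_le nat (oseg m).
  exact: inj_le_trans (inj_le_oeq omw) (inj_le_oseg wm).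
apply: inj_le_trans (inj_le_graph S T) _.
apply: (@inj_le_trans _ (oseg m -> bool)).
  apply: inj_le_bool; apply: inj_le_trans (hessenberg minf).
  apply: inj_le_prod; first exact: inj_le_trans Sa (inj_le_oseg am).
  exact: inj_le_trans Tb (inj_le_oseg bm).
apply: (@inj_le_trans _ (Defs.bseq kappa)).
  exists (fun s => existT _ m s) => s t st.
  by have := projT2_eq st; rewrite (Prop_irrelevance (projT1_eq st) erefl).
have : ([set: Defs.bseq kappa] #<= [set: kappa])%card.
  by have := kappa_pow; rewrite /pow_lt_eq card_eq_le => /andP[].
by move/inj_leP.
Qed.
End SmallFunctions.

(** * Rearranging unions and intersections *)

(** Indices outside the range of the injection contribute the empty set.  Unions
    can thus be indexed by any type that injects into [kappa], and no ordinal
    arithmetic is needed to merge or split them. *)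
Lemma bigcup_reindex (S T X : Type) (P : set X -> Prop) (A : T -> set X) :
  inj_le T S -> P set0 -> (forall t, P (A t)) ->
  exists A' : S -> set X,
    (forall s, P (A' s)) /\ \bigcup_t A t = \bigcup_s A' s.
Proof.
move=> [e ei] P0 PA; exists (fun s => \bigcup_(t in [set t | e t = s]) A t).
split.
  move=> s; have [[t <-]|no] := pselect (exists t, e t = s).
    suff -> : [set t' | e t' = e t] = [set t] by rewrite bigcup_set1.
    by apply/seteqP; split=> t' /=; [move/ei|move=> ->].
  suff -> : [set t | e t = s] = set0 by rewrite bigcup_set0.
  by apply/seteqP; split=> // t /= es; apply: no; exists t.
apply/seteqP; split=> [x [t _ Ax]|x [s _ [t _ Ax]]]; last by exists t.
by exists (e t) => //; exists t.
Qed.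

Lemma bigcup_bigcap_distr (S T X : Type) (D : S -> T -> set X) :
  \bigcup_s \bigcap_t D s t = \bigcap_(g : S -> T) \bigcup_s D s (g s).
Proof.
apply/seteqP; split=> [x [s _ Dx] g _|x Dx]; first by exists s => //; exact: Dx.
apply: contrapT => nx.
have /choice[g gP] : forall s, exists t, ~ D s t x.
  move=> s; apply: contrapT => no; apply: nx; exists s => // t _.
  by apply: contrapT => h; apply: no; exists t.
by have [s _ /(gP s)] := Dx g Logic.I.
Qed.

(** Distributing and then grouping the [s] by the value of the choice function:
    the outer union then runs over [J], whatever the size of [S]. *)
Lemma bigcup_bigcap_fiber (S J Y : Type) (D : S -> J -> set Y) :
  \bigcup_s \bigcap_j D s j =
  \bigcap_(f : S -> J) \bigcup_j \bigcup_(s : {s | f s = j}) D (sval s) j.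
Proof.
rewrite bigcup_bigcap_distr; apply: eq_bigcapr => f _.
apply/seteqP; split=> x.
  move=> [s _ Dx]; exists (f s) => //.
  by exists (exist (fun s' => f s' = f s) s erefl).
by move=> [j _ [[s /= e] _ Dx]]; exists s => //; rewrite e.
Qed.

(** * The Borel hierarchy with unions of length at most kappa *)

Section Hierarchy.
Variables (kappa : Ord) (X : topologicalType).
Hypothesis kappa_inf : inj_le nat kappa.
Hypothesis open_Fsigma : forall U : set X, open U ->
  exists F : kappa -> set X, (forall k, closed (F k)) /\ U = \bigcup_k F k.

Local Notation Sigma := (@Sigma0 X (card_succ kappa)).
Local Notation Pi := (@Pi0 X (card_succ kappa)).
Local Notation Delta := (@Delta0 X (card_succ kappa)).

Lemma Sigma_oeq a b U : oeq a b -> Sigma a U -> Sigma b U.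
Proof.
move=> ab S; case: S ab => {a U} [a U a1 oU|a d A c a1 dk c1 ca cA] ab.
  by apply: Sigma0_open oU; exact: oeq_trans (oeq_sym ab) a1.
apply: (Sigma0_union _ dk c1) => // [|i]; first exact: olt_oeqr ab.
exact: olt_oeqr ab.
Qed.

Lemma Sigma_open a U : oeq a o1 -> Sigma a U -> open U.
Proof.
move=> a1 S; case: S a1 => // {a U} a d A c a1 _ _ _ _ /(olt_oeqr a1).
by move/olt_irr.
Qed.

Definition Pi_below a (A : set X) := exists b, [/\ ole o1 b, olt b a & Pi b A].

Lemma Pi_below_mono a a' A : ole a a' -> Pi_below a A -> Pi_below a' A.
Proof.
move=> aa' [b [b1 ba bA]]; exists b; split=> //; exact: olt_ole_trans aa'.
Qed.

Lemma closed_Pi_below a A : olt o1 a -> closed A -> Pi_below a A.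
Proof.
move=> a1 cA; exists o1; split=> //; first exact: ole_refl.
by apply: Sigma0_open; [exact: oeq_refl|exact: closed_openC].
Qed.

Lemma Sigma_union T (A : T -> set X) a : olt o1 a -> inj_le T kappa ->
  (forall t, Pi_below a (A t)) -> Sigma a (\bigcup_t A t).
Proof.
move=> a1 Tk PA; have [|A' [PA' ->]] := bigcup_reindex Tk _ PA.
  by apply: closed_Pi_below => //; exact: closed0.
have /choice[b bP] := PA'.
apply: (@Sigma0_union X _ a kappa A' b) => // [|i|i|i].
- exact: lt_card_succ.
all: by case: (bP i).
Qed.

Lemma Sigma_unionE a U : olt o1 a -> Sigma a U ->
  exists A : kappa -> set X, (forall k, Pi_below a (A k)) /\ U = \bigcup_k A k.
Proof.
move=> a1 S; case: S a1 => {a U} [a U a1 _ /olt_oeqr/(_ a1)/olt_irr[]|].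
move=> a d A c a1 /lt_card_succ_inj_le dk c1 ca cA _.
apply: (bigcup_reindex (P := Pi_below a)) => //; last first.
  by move=> i; exists (c i); split.
by apply: closed_Pi_below => //; exact: closed0.
Qed.

Lemma unit_inj_le : inj_le unit kappa.
Proof. by apply: inj_le_trans kappa_inf; exists (fun=> 0) => -[] []. Qed.

Lemma Pi_lt_Sigma b a A : ole o1 b -> olt b a -> Pi b A -> Sigma a A.
Proof.
move=> b1 ba bA; have -> : A = \bigcup_(t : unit) A.
  by apply/seteqP; split=> [x Ax|x [_ _ Ax]] //; exists tt.
apply: Sigma_union; [exact: ole_olt_trans ba|exact: unit_inj_le|].
by move=> _; exists b.
Qed.

Lemma Sigma_lt_Pi b a A : ole o1 b -> olt b a -> Sigma b A -> Pi a A.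
Proof.
move=> b1 ba bA; rewrite /Pi0 /=; apply: (Pi_lt_Sigma b1 ba).
by rewrite /Pi0 /= setCK.
Qed.

(** Above level 1 a union of sets from lower levels is also one for every higher
    level.  At level 1 the hypothesis that open sets are unions of closed sets
    is what makes the hierarchy increasing. *)
Lemma Sigma_lt b a A : ole o1 b -> olt b a -> Sigma b A -> Sigma a A.
Proof.
move=> b1 ba; have a1 := ole_olt_trans b1 ba.
case: (b1) => [b2 /(Sigma_unionE b2)[B [BP ->]]|/oeq_sym b2 /(Sigma_open b2)].
  apply: Sigma_union => //; first exact: inj_le_refl.
  by move=> k; apply: Pi_below_mono (BP k); left.
move=> /open_Fsigma[F [cF ->]].
apply: Sigma_union => //; first exact: inj_le_refl.
by move=> k; exact: closed_Pi_below.
Qed.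

Lemma Sigma_lt_Delta b a A : ole o1 b -> olt b a -> Sigma b A -> Delta a A.
Proof.
by move=> b1 ba bA; split; [exact: Sigma_lt bA|exact: Sigma_lt_Pi bA].
Qed.

Lemma Sigma_le b a A : ole o1 b -> ole b a -> Sigma b A -> Sigma a A.
Proof. by move=> b1 [ba|ba]; [exact: Sigma_lt|exact: Sigma_oeq]. Qed.

(** A union of unions is indexed by [T * kappa], which injects into [kappa]. *)
Lemma Sigma_bigcup a T (A : T -> set X) : ole o1 a -> inj_le T kappa ->
  (forall t, Sigma a (A t)) -> Sigma a (\bigcup_t A t).
Proof.
move=> [a1 Tk AS|/oeq_sym a1 _ AS]; last first.
  apply: Sigma0_open => //; apply: bigcup_open => t _.
  exact: Sigma_open (AS t).
have /choice[B BP] : forall t, exists B : kappa -> set X,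
    (forall k, Pi_below a (B k)) /\ A t = \bigcup_k B k.
  by move=> t; exact: Sigma_unionE.
have -> : \bigcup_t A t = \bigcup_(p : T * kappa) B p.1 p.2.
  apply/seteqP; split=> x.
    by move=> [t _]; rewrite (BP t).2 => -[k _ Bx]; exists (t, k).
  by move=> [[t k] _ Bx]; exists t => //; rewrite (BP t).2; exists k.
apply: Sigma_union => //.
  apply: inj_le_trans (hessenberg kappa_inf).
  by apply: inj_le_prod => //; exact: inj_le_refl.
by move=> [t k]; exact: (BP t).1.
Qed.

Lemma Pi_bigcap a T (A : T -> set X) : ole o1 a -> inj_le T kappa ->
  (forall t, Pi a (A t)) -> Pi a (\bigcap_t A t).
Proof.
by move=> a1 Tk AP; rewrite /Pi0 /= setC_bigcap; exact: Sigma_bigcup.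
Qed.

Lemma Sigma_Bor a U : Sigma a U -> @Bor X (card_succ kappa) U.
Proof.
elim=> {a U} [a U _ oU|a d A c _ dk _ _ _ IH]; first exact: sub_gen_smallest.
move=> F [[FC FU] oF]; apply: (FU _ dk) => i.
by rewrite -[A i]setCK; apply: (FC); exact: (IH i F (conj (conj FC FU) oF)).
Qed.

(** A level closed under complements contains the open sets and is closed under
    unions, so it already equals [Bor], against the minimality of [Bor_ord]. *)
Lemma not_Sigma_sub_Pi a : ole o1 a -> olt a (Bor_ord X (card_succ kappa)) ->
  ~ (Sigma a : set (set X)) `<=` Pi a.
Proof.
move=> a1 aord SP.
have SB : (Sigma a : set (set X)) = @Bor X (card_succ kappa).
  apply/seteqP; split=> U; first exact: Sigma_Bor.
  apply; split=> [|V oV]; last first.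
    apply: (@Sigma_le o1) => //; first exact: ole_refl.
    by apply: Sigma0_open => //; exact: oeq_refl.
  split=> [V /SP//|d /lt_card_succ_inj_le dk V VS].
  exact: Sigma_bigcup.
have [] := @omin_spec (fun a =>
    ole o1 a /\ (Sigma a : set (set X)) = @Bor X (card_succ kappa)).
  by exists a.
by move=> _ /(_ a (conj a1 SB))/ole_not_olt; apply.
Qed.

(** * Collapse at limit levels *)

(** The family [C] stands for either [Pi a] or [Delta a], so that the arguments
    below treat both at once. *)
Section Collapse.
Variables (a : Ord) (C : set (set X)).
Hypothesis Delta_C : Delta a `<=` C.
Hypothesis C_Pi : C `<=` Pi a.

(** Take [f] cofinal in [a].  A set in [Sigma a] is a union of sets of levels
    below [a]; grouping those of level below [f i] gives the empty set or a
    member of [Sigma (oseg (f i))], hence a member of [Delta a], for each [i]. *)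
Lemma Sigma_sub_Pi_limit : olt o1 a -> ~ is_succ a -> closed_union (cof a) C ->
  (Sigma a : set (set X)) `<=` Pi a.
Proof.
move=> a1 a_lim CU U /(Sigma_unionE a1)[A [AP ->]].
have no_max (m : a) : exists m', ltel m m'.
  apply: contrapT => no; apply: a_lim; exists (oseg m).
  by apply: oeq_oS_max => x mx; apply: no; exists x.
have /choice[c cP] : forall k, exists c : a,
    ole o1 (oseg c) /\ Pi (oseg c) (A k).
  move=> k; have [b [b1 [c bc] bA]] := AP k; exists c; split.
    case: b1 => [b1|b1]; [left; exact: olt_oeqr bc|right; exact: oeq_trans bc].
  exact: Sigma_oeq bA.
have [f fc] := cof_cofinal a.
pose B i := \bigcup_(k : {k | ltel (c k) (f i)}) A (sval k).
have -> : \bigcup_k A k = \bigcup_i B i.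
  apply/seteqP; split=> x; last by move=> [i _ [k _ Ax]]; exists (sval k).
  move=> [k _ Ax]; have [m cm] := no_max (c k).
  have [i mi] := fc m; have ci : ltel (c k) (f i).
    by case: mi => [<-//|]; exact: ltel_trans.
  by exists i => //; exists (exist _ k ci).
apply: C_Pi; apply: CU => i; apply: Delta_C.
have [[k ki]|no] := pselect (exists k, ltel (c k) (f i)); last first.
  suff -> : B i = set0.
    apply: (@Sigma_lt_Delta o1) => //; first exact: ole_refl.
    by apply: Sigma0_open; [exact: oeq_refl|exact: open0].
  by apply/seteqP; split=> // x [[k ki]]; case: no; exists k.
(* f i is above 1 because some member of the group has level at least 1 *)
have fi1 : olt o1 (oseg (f i)) by apply: ole_olt_trans (cP k).1 (olt_osegs ki).
apply: (@Sigma_lt_Delta (oseg (f i))); [by left|exact: olt_oseg|].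
apply: Sigma_union => //; first exact: inj_le_sig.
move=> [k' k'i]; exists (oseg (c k')); have [c1 cA] := cP k'.
by split=> //; exact: olt_osegs.
Qed.
End Collapse.
End Hierarchy.

(** * Collapse at successor levels *)

Section Successor.
Variables (kappa : Ord) (X : topologicalType).
Hypothesis kappa_sing : singular_cardinal kappa.
Hypothesis kappa_pow : pow_lt_eq kappa.
Hypothesis open_Fsigma : forall U : set X, open U ->
  exists F : cof kappa -> set X, (forall j, closed (F j)) /\ U = \bigcup_j F j.

Local Notation Sigma := (@Sigma0 X (card_succ kappa)).
Local Notation Pi := (@Pi0 X (card_succ kappa)).
Local Notation Delta := (@Delta0 X (card_succ kappa)).

Lemma singular_inf : inj_le nat kappa.
Proof. by have [_ /inj_le_olt] := kappa_sing. Qed.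

Lemma inj_le_cof : inj_le (cof kappa) kappa.
Proof. by have [_ _ /inj_le_olt] := kappa_sing. Qed.

Lemma open_Fsigma_widen (U : set X) : open U ->
  exists F : kappa -> set X, (forall j, closed (F j)) /\ U = \bigcup_j F j.
Proof.
move=> /open_Fsigma[F [Fc ->]].
exact: (bigcup_reindex (P := closed) inj_le_cof closed0 Fc).
Qed.

Let kappa_inf := singular_inf.
Let open_Fsigma_k := open_Fsigma_widen.

Variables (a b : Ord) (C : set (set X)).
Hypothesis b1 : ole o1 b.
Hypothesis ab : oeq a (oS b).
Hypothesis Delta_C : Delta a `<=` C.
Hypothesis C_Pi : C `<=` Pi a.
Hypothesis CU : closed_union (cof kappa) C.

Let ba : olt b a.
Proof. exact: olt_oeqr (olt_oS b) (oeq_sym ab). Qed.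

Let a1 : olt o1 a.
Proof. exact: ole_olt_trans ba. Qed.

Variable h : cof kappa -> kappa.
Hypothesis h_cof : forall x, exists j, ltel x (h j).
Hypothesis h_pos : forall j, exists x, ltel x (h j).

Lemma Pi_below_Pi P : Pi_below kappa a P -> Pi b P.
Proof.
move=> [c [c1 ca cP]]; apply: (Sigma_le open_Fsigma_k c1 _ cP).
by apply: olt_oS_ole; exact: olt_oeqr ab.
Qed.

(** The complement of [P] is a union of [kappa] sets of lower level; cutting
    [kappa] into the segments [oseg (h j)] writes [P] as an intersection of
    [cof kappa] sets, each an intersection of fewer than [kappa] sets of
    [Sigma b].  At level 1 a constant family of open sets does, since open sets
    are unions of only [cof kappa] closed sets. *)
Lemma Pi_small_bigcap P : Pi b P ->
  exists B : forall j : cof kappa, oseg (h j) -> set X,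
    [/\ forall j t, Sigma b (B j t), forall j, Sigma a (\bigcap_t B j t) &
      P = \bigcap_j \bigcap_t B j t].
Proof.
rewrite /Pi0 /= => SP; case: (b1) => [b2|/oeq_sym b2].
  have [Q [QP PQ]] := Sigma_unionE b2 SP.
  exists (fun j t => ~` Q (sval t)); split.
  - move=> j t; have [c [c1 cb cQ]] := QP (sval t).
    exact: (Sigma_lt open_Fsigma_k c1 cb).
  - move=> j; apply: (Pi_lt_Sigma kappa_inf b1 ba).
    apply: (Pi_bigcap kappa_inf b1) => [|t]; first exact: inj_le_sig.
    have [c [c1 cb cQ]] := QP (sval t).
    exact: (Sigma_lt_Pi kappa_inf c1 cb).
  rewrite -[P]setCK PQ setC_bigcup.
  apply/seteqP; split=> [x Qx j _ t _|x Qx k _]; first exact: Qx.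
  by have [j kj] := h_cof k; exact: (Qx j Logic.I (exist _ k kj)).
have [F [Fc PF]] := open_Fsigma (Sigma_open b2 SP).
have SF j : Sigma b (~` F j).
  by apply: Sigma0_open => //; exact: closed_openC.
have capF j : \bigcap_(t : oseg (h j)) ~` F j = ~` F j.
  have [x xh] := h_pos j; apply/seteqP; split=> y Fy; last by move=> _ _.
  exact: (Fy (exist _ x xh) Logic.I).
exists (fun j t => ~` F j); split=> // [j|].
  by rewrite capF; exact: (Sigma_lt open_Fsigma_k b1 ba).
rewrite -[P]setCK PF setC_bigcup; apply: eq_bigcapr => j _.
by rewrite capF.
Qed.

(** With [A x = \bigcap_j D x j] as in [Pi_small_bigcap], the union of the [A x]
    is the intersection, over [f : oseg l -> cof kappa], of the unions over [j]
    of [E f j = \bigcup_(x | f x = j) D x j].  There are at most [kappa] such [f].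
    For fixed [j] all the [D x j] are intersections over the same segment
    [oseg (h j)], so the distributive law turns [E f j] into an intersection of
    at most [kappa] sets of [Sigma b]; thus [E f j] is in [Delta a].  Distributing
    without first grouping by [j] would need [kappa ^ l] indices, which can
    exceed [kappa].  The price is the union over [j], and it stays inside [Pi a]
    because [C] is closed under unions of size [cof kappa]. *)
Lemma Pi_small_bigcup (l : kappa) (A : oseg l -> set X) :
  (forall x, Pi b (A x)) -> C (\bigcup_x A x).
Proof.
move=> AP.
have /choice[B BP] := fun x => Pi_small_bigcap (AP x).
have [v /inj_le_oeq cv] : olt (cof kappa) kappa by have [] := kappa_sing.
have omk : olt omega kappa by have [] := kappa_sing.
have lk : inj_le (oseg l) kappa by exact: inj_le_sig.
pose E (f : oseg l -> cof kappa) j :=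
  \bigcup_(s : {s | f s = j}) \bigcap_t B (sval s) j t.
have SE f j : Sigma a (E f j).
  apply: (Sigma_bigcup kappa_inf) => [||s]; first by left.
    exact: inj_le_trans (inj_le_sig _) lk.
  by have [] := BP (sval s).
have PE f j : Pi a (E f j).
  rewrite /E bigcup_bigcap_distr.
  apply: (Pi_bigcap kappa_inf) => [||g]; first by left.
    exact: (inj_le_small_fun omk kappa_pow (inj_le_sig _) (inj_le_refl _)).
  apply: (Sigma_lt_Pi kappa_inf b1 ba).
  apply: (Sigma_bigcup kappa_inf b1) => [|s].
    exact: inj_le_trans (inj_le_sig _) lk.
  by have [] := BP (sval s).
apply: Delta_C; split.
  apply: (Sigma_union a1 lk) => x; exists b; split=> //; exact: AP.
have -> : \bigcup_x A x = \bigcup_x \bigcap_j \bigcap_t B x j t.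
  by apply: eq_bigcupr => x _; have [] := BP x.
rewrite bigcup_bigcap_fiber.
apply: (Pi_bigcap kappa_inf) => [||f]; first by left.
  exact: (inj_le_small_fun omk kappa_pow (inj_le_refl _) cv).
by apply: C_Pi; apply: CU => j; apply: Delta_C; split; [exact: SE|exact: PE].
Qed.

(** A union of [kappa] sets is a union of [cof kappa] unions of fewer than
    [kappa] sets, and [Pi_small_bigcup] applies to each of these. *)
Lemma Sigma_sub_Pi_succ : (Sigma a : set (set X)) `<=` Pi a.
Proof.
move=> U /(Sigma_unionE a1)[A [AP ->]].
have -> : \bigcup_k A k = \bigcup_j \bigcup_(k : oseg (h j)) A (sval k).
  apply/seteqP; split=> x; last by move=> [j _ [k _ Ax]]; exists (sval k).
  move=> [k _ Ax]; have [j kj] := h_cof k.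
  by exists j => //; exists (exist _ k kj).
apply: C_Pi; apply: CU => j; apply: Pi_small_bigcup => k.
by apply: Pi_below_Pi; exact: AP.
Qed.

End Successor.

(** * Clopen sets of the bounded topology *)

Section Cantor.
Variable kappa : Ord.
Local Notation Cantor := (cantor kappa).

Lemma open_cone (s : Defs.bseq kappa) : open (cone s : set Cantor).
Proof.
exists [set (cone s : set Cantor)].
  by move=> _ ->; apply: (finI_from1 id); exists s.
by rewrite bigcup_set1.
Qed.

Definition agree (d : kappa) (x y : Cantor) := forall i, ltel i d -> x i = y i.

(** Such a set is the union of the cones of length [d] around its points. *)
Lemma open_invariant (d : kappa) (W : set Cantor) :
  (forall x y, agree d x y -> W x -> W y) -> open W.
Proof.
move=> Winv.
pose s (x : Cantor) : Defs.bseq kappa := existT _ d (fun i => x (sval i)).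
have -> : W = \bigcup_(x in W) cone (s x).
  apply/seteqP; split=> [x Wx|y [x Wx xy]]; first by exists x.
  by apply: Winv Wx => i id; rewrite (xy (exist _ i id)).
by apply: bigcup_open => x _; exact: open_cone.
Qed.

Lemma agree_le (d d' : kappa) x y : ~ ltel d' d -> agree d' x y -> agree d x y.
Proof.
move=> dd' xy i id; apply: xy; have [/dd'[]|->//|h] := ltel_total d' d.
exact: ltel_trans h.
Qed.

(** An open set is a union of finite intersections of cones, and finitely many
    lengths below [kappa] have a common bound. *)
Lemma open_agree (d0 : kappa) (V : set Cantor) (x : Cantor) : open V -> V x ->
  exists d, forall y, agree d x y -> V y.
Proof.
move=> [D DV <-] [W DW Wx].
suff [d dW] : exists d, forall y, agree d x y -> W y.
  by exists d => y /dW Wy; exists W.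
have [F FD FW] := DV _ DW; move: Wx; rewrite -FW bigcap_fset big_seq.
apply: (big_ind (fun W : set Cantor =>
  W x -> exists d, forall y, agree d x y -> W y)).
- by exists d0.
- move=> W1 W2 IH1 IH2 [/IH1[d1 h1] /IH2[d2 h2]]; exists (omax d1 d2) => y xy.
  split; [apply: h1|apply: h2]; apply: agree_le xy; [exact: omaxl|exact: omaxr].
move=> i /FD; rewrite inE => -[[d s] _ <-] /= sx; exists d => y xy j /=.
by rewrite -xy ?sx //; exact: svalP j.
Qed.

Variable h : cof kappa -> kappa.
Hypothesis h_cof : forall x, exists j, ltel x (h j).

(** [W j] collects the cones of length [h j] contained in [V].  Both [W j] and its
    complement depend only on coordinates below [h j], hence are open. *)
Lemma open_clopen_union (d0 : kappa) (V : set Cantor) : open V ->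
  exists W : cof kappa -> set Cantor,
    [/\ forall j, open (W j), forall j, open (~` W j) & V = \bigcup_j W j].
Proof.
move=> oV; pose W j := [set x : Cantor | forall y, agree (h j) x y -> V y].
have Winv j x y : agree (h j) x y -> W j x -> W j y.
  by move=> xy Wx z yz; apply: Wx => i ij; rewrite xy // yz.
exists W; split=> [j|j|].
- exact: open_invariant (@Winv j).
- apply: (@open_invariant (h j)) => x y xy nx Wy; apply: nx.
  by apply: Winv Wy => i ij; rewrite xy.
apply/seteqP; split=> x; last by move=> [j _ Wx]; exact: Wx.
move=> Vx; have [d dV] := open_agree d0 oV Vx; have [j dj] := h_cof d.
by exists j => // y xy; apply: dV; apply: agree_le xy; exact: ltel_asym.
Qed.
End Cantor.

Lemma embeds_open_clopen_union (kappa : Ord) (X : topologicalType)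
    (h : cof kappa -> kappa) (d0 : kappa) (U : set X) :
  (forall x, exists j, ltel x (h j)) -> embeds X (cantor kappa) -> open U ->
  exists W : cof kappa -> set X,
    [/\ forall j, open (W j), forall j, open (~` W j) & U = \bigcup_j W j].
Proof.
move=> h_cof [f [_ fo]] oU.
have of_ (V : set (cantor kappa)) : open V -> open (f @^-1` V).
  by move=> oV; rewrite fo; exists V.
have [V oV <-] : [set f @^-1` V | V in open] U by rewrite -fo.
have [W [oW cW ->]] := open_clopen_union h_cof d0 oV.
exists (fun j => f @^-1` (W j)); split=> [j|j|].
- exact: of_.
- by rewrite preimage_setC; exact: of_.
- exact: preimage_bigcup.
Qed.

(** * Failure of the closure properties *)

Lemma closed_interC (T : Type) (I : Ord) (F G : set (set T)) :
  (forall A, F A <-> G (~` A)) -> closed_inter I F -> closed_union I G.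
Proof.
move=> FG Fi A GA; rewrite -[\bigcup_i A i]setCK; apply/FG.
by rewrite setC_bigcup; apply: Fi => i; apply/FG; rewrite setCK.
Qed.

Theorem corollary5p9 (kappa : Ord) (X : topologicalType)
  (kappa_sing : singular_cardinal kappa)
  (kappa_pow : pow_lt_eq kappa)
  (X_nonempty : [set: X] !=set0)
  (X_regular : regular_space X)
  (X_hausdorff : hausdorff_space X)
  (X_weight : weight_le X kappa)
  (X_open : @Sigma0 X kappa o1 `<=` @Sigma0 X (card_succ (cof kappa)) o2)
  (alpha : Ord)
  (alpha_ge1 : ole o1 alpha)
  (alpha_lt : olt alpha (Bor_ord X (card_succ kappa))) :
  let Sig := @Sigma0 X (card_succ kappa) alpha in
  let Pi := @Pi0 X (card_succ kappa) alpha in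
  let Del := @Delta0 X (card_succ kappa) alpha in
  let ahat := hat kappa alpha in
  [/\ ~ closed_compl Sig /\ ~ closed_inter ahat Sig,
      ~ closed_compl Pi /\ ~ closed_union ahat Pi,
      olt o1 alpha -> ~ closed_union ahat Del /\ ~ closed_inter ahat Del
    & oeq alpha o1 -> embeds X (cantor kappa) ->
        ~ closed_union ahat Del /\ ~ closed_inter ahat Del].
Proof.
move=> Sig Pi Del ahat.
have kappa_inf := singular_inf kappa_sing.
have kc : is_card kappa by have [] := kappa_sing.
have [h [h_cof h_pos]] := cofinal_strict kc kappa_inf.
have [d0 _] : exists d0 : kappa, True by have [f _] := kappa_inf; exists (f 0).
have open_Fsigma (U : set X) : open U ->
    exists F : cof kappa -> set X,
      (forall j, closed (F j)) /\ U = \bigcup_j F j.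
  move=> oU; have := X_open U (Sigma0_open _ (oeq_refl _) oU).
  move=> /Sigma_unionE[|F [FP ->]]; first exact: olt_o1_o2.
  exists F; split=> // j; rewrite -openC.
  have [c [c1 c2 cF]] := FP j; apply: Sigma_open cF.
  have [c1'|c1'//] := olt_oS_ole c2; case: (ole_not_olt c1 c1').
have open_Fsigma_k := open_Fsigma_widen kappa_sing open_Fsigma.
have SP := not_Sigma_sub_Pi kappa_inf open_Fsigma_k alpha_ge1 alpha_lt.
have not_closed_union (C : set (set X)) : olt o1 alpha ->
    Del `<=` C -> C `<=` Pi -> ~ closed_union ahat C.
  move=> a1 DC CP; rewrite /ahat /hat.
  case: pselect => [[b ab] CU|a_lim CU]; apply: SP.
    have b1 : ole o1 b by apply: olt_oS_ole; exact: olt_oeqr ab.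
    exact: (Sigma_sub_Pi_succ kappa_sing kappa_pow open_Fsigma b1 ab DC CP CU
              h_cof h_pos).
  exact: (Sigma_sub_Pi_limit kappa_inf open_Fsigma_k DC CP a1 a_lim CU).
(* level 1 counts as a successor level *)
have hat1 : oeq alpha o1 -> ahat = cof kappa.
  by move=> a1; rewrite /ahat /hat; case: pselect => // -[]; exists o0.
have PiU : ~ closed_union ahat Pi.
  case: alpha_ge1 => [a1|/oeq_sym a1].
    by apply: not_closed_union => // A [].
  rewrite hat1 // => PU; apply: SP => U /(Sigma_open a1)/open_Fsigma[F [Fc ->]].
  by apply: PU => j; apply: Sigma0_open => //; exact: closed_openC.
have SigPi A : Sig A <-> Pi (~` A) by rewrite /Pi /Pi0 /= setCK.
have DelDel A : Del A <-> Del (~` A).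
  by rewrite /Del /Delta0 /Pi0 /= setCK; split=> -[].
have DelI : ~ closed_union ahat Del ->
    ~ closed_union ahat Del /\ ~ closed_inter ahat Del.
  by move=> DU; split=> // /(closed_interC DelDel).
split.
- split; last by move/(closed_interC SigPi).
  by move=> SC; apply: SP => A /SC.
- split=> // PC; apply: SP => A SA; rewrite -[A]setCK; apply: PC.
  by rewrite /Pi /Pi0 /= setCK.
- by move=> a1; apply: DelI; apply: not_closed_union => // A [].
move=> a1 Xe; apply: DelI; rewrite hat1 // => DU; apply: SP => U.
move=> /(Sigma_open a1)/(embeds_open_clopen_union d0 h_cof Xe)[W [oW cW ->]].
suff [] : Del (\bigcup_j W j) by [].
by apply: DU => j; split; apply: Sigma0_open.
Qed.
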